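(* Let $L$ be a finite geometric lattice of rank $r$. The operator $D_\beta=S^{-1}U^\beta K$ on $\mathbb R[L]$ satisfies \[ D_\beta v_0=0,\qquad D_\beta v_k=k\,v_{k-1}\quad(1\le k\le r). \] Under the isomorphism $\mathbb R[t]/(t^{r+1})\to\mathcal R(L)=\mathrm{span}\{v_0,\dots,v_r\}$, $t^k\mapsto v_k$, the operator $U$ restricts to multiplication by $t$ and $D_\beta$ restricts to $d/dt$ on $\mathcal R(L)$.
   Context: $L$ has atom set $A$, rank function $\mathrm{rk}$, bottom $\hat 0$, top $\hat 1$; $L_k$ is the set of elements of rank $k$; $\mathbb R[L]$ is the real vector space with basis $(e_x)_{x\in L}$. For an atom $a$, the linear operator $L_a$ is $L_ae_x=e_{x\vee a}$ if $a\not\le x$ and $L_ae_x=0$ if $a\le x$ (multiplication by $e_a$ in the graded Möbius algebra). Put $U=\sum_{a\in A}L_a$. For $x\in L_k$, $\beta_x$ is the number of tuples $(a_1,\dots,a_k)\in A^k$ with $a_1\vee\dots\vee a_k=x$ (so $\beta_{\hat 0}=1$). Put $v_k=U^ke_{\hat 0}=\sum_{x\in L_k}\beta_xe_x$ for $0\le k\le r$. Equip $\mathbb R[L]$ with the inner product $\langle e_x,e_y\rangle_\beta=\delta_{x,y}/\beta_x$; let $L_a^\beta$ be the adjoint of $L_a$ and $U^\beta=\sum_{a\in A}L_a^\beta$ the adjoint of $U$. Let $Ke_x=\mathrm{rk}(x)e_x$, $s(x)=|A|-|\{a\in A:a\le x\}|$, and $S^{-1}e_x=s(x)^{-1}e_x$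 for $x<\hat 1$, $S^{-1}e_{\hat 1}=0$. Here $d/dt$ on $\mathbb R[t]/(t^{r+1})$ means the linear map with $1\mapsto 0$ and $t^k\mapsto kt^{k-1}$ for $1\le k\le r$. *)

(* Defs.v *)
From HB Require Import structures.
From mathcomp Require Import all_boot all_order all_algebra.
From mathcomp Require Import reals.

Set Implicit Arguments.
Unset Strict Implicit.
Unset Printing Implicit Defensive.

Import Order.TTheory GRing.Theory Num.Theory.
Local Open Scope ring_scope.

Section Lattice.
Context {d : Order.disp_t} {L : finTBLatticeType d}.

Definition covers (x y : L) : bool :=
  (x < y)%O && [forall z : L, ~~ ((x < z)%O && (z < y)%O)].

Definition atom (a : L) : bool := covers \bot%O a.

(* The two rank-function axioms determine rk uniquely: it is the common length
   of all maximal chains of [\bot, x]. *)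
Record geometric_lattice (rk : L -> nat) : Prop := GeometricLattice {
  rk_bottom : rk \bot%O = 0%N;
  rk_covers : forall x y : L, covers x y -> rk y = (rk x).+1;
  rk_semimodular : forall x y : L,
    (rk (Order.join x y) + rk (Order.meet x y) <= rk x + rk y)%N;
  atomistic : forall x : L,
    x = (\join_(a : L | atom a && (a <= x)) a)%O
}.

Definition beta (rk : L -> nat) (x : L) : nat :=
  #|[set t : (rk x).-tuple L |
      all atom t && ((\join_(a <- t) a)%O == x)]|.

Definition corank (x : L) : nat :=
  (#|[set a : L | atom a]| - #|[set a : L | atom a && (a <= x)%O]|)%N.

Lemma covered_ex (x y : L) :
  (x < y)%O -> exists2 z : L, covers z y & (x <= z)%O.
Proof.
move=> xy; pose P z := (x <= z)%O && (z < y)%O.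
have Px : P x by rewrite /P lexx.
case: (arg_maxnP (fun z : L => #|[set t : L | (t <= z)%O]|) Px).
move=> z /andP[xz zy] zmax; exists z => //; rewrite /covers zy /=.
apply/forallP => t; apply/negP => /andP[zt ty].
have /zmax : P t by rewrite /P ty (le_trans xz (ltW zt)).
apply/negP; rewrite /= -ltnNge; apply: proper_card; apply/properP; split.
  by apply/subsetP => s; rewrite !inE => /le_trans; apply; exact: ltW.
by exists t; rewrite !inE ?lexx // lt_geF.
Qed.

Lemma rk_lt (rk : L -> nat) (geo : geometric_lattice rk) (x y : L) :
  (x < y)%O -> (rk x < rk y)%N.
Proof.
have [n] := ubnP (rk y); elim: n => // n IHn in y *; rewrite ltnS => yn xy.
have [z zy xz] := covered_ex xy; rewrite (rk_covers geo zy) ltnS.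
move: xz; rewrite le_eqVlt => /predU1P[->//|xz].
by apply/ltnW/IHn => //; rewrite -(rk_covers geo zy).
Qed.

Lemma beta_gt0 (rk : L -> nat) (geo : geometric_lattice rk) (x : L) :
  (0 < beta rk x)%N.
Proof.
suff [t tx tP] : exists2 t : seq L, size t = rk x &
    all atom t && ((\join_(a <- t) a)%O == x).
  apply/card_gt0P; exists (tcast tx (in_tuple t)).
  by rewrite inE val_tcast.
have [n] := ubnP (rk x); elim: n => // n IHn in x *; rewrite ltnS => xn.
have [->|x0] := eqVneq x \bot%O.
  by exists [::]; rewrite ?(rk_bottom geo) // big_nil eqxx.
have [|y yx _] := @covered_ex \bot%O x; first by rewrite lt0x.
have rkx := rk_covers geo yx.
have [|t ty /andP[t_at /eqP tjoin]] := IHn y; first by rewrite -rkx.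
have [xy /forallP ymax] := andP yx.
have [a /andP[a_at ax] ay] : exists2 a : L, atom a && (a <= x)%O & ~~ (a <= y)%O.
  apply/exists_inP; apply: contraTT xy => /exists_inPn H.
  apply/negbT/le_gtF; rewrite (atomistic geo x); apply/joinsP => a /H.
  by rewrite negbK.
exists (a :: t); first by rewrite /= ty rkx.
rewrite /= a_at t_at big_cons tjoin /=.
have := ymax (Order.join a y); rewrite negb_and => /orP[].
  by rewrite lt_neqAle leUr andbT negbK eq_sym eq_joinr (negPf ay).
by rewrite lt_neqAle leUx ax (ltW xy) !andbT negbK.
Qed.

End Lattice.

Lemma linfun_linear (F : fieldType) (U W : vectType F) (f : U -> W) :
  linear f -> linfun f =1 f.
Proof.
move=> f_lin; pose g : {linear U -> W} :=
  HB.pack f (GRing.isLinear.Build _ _ _ _ f f_lin).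
exact: (lfunE g).
Qed.

Section Operators.
Context {R : realType} {d : Order.disp_t} {L : finTBLatticeType d}.
Variable rk : L -> nat.
(* R[L], with the element \sum_x c_x e_x encoded as the function x |-> c_x. *)
Local Notation V := {ffun L -> R^o}.

Definition e (x : L) : V := [ffun y => (y == x)%:R].

Definition linext (f : L -> V) : 'End(V) :=
  linfun (fun v : V => \sum_(x : L) v x *: f x).

Definition atom_op (a : L) : 'End(V) :=
  linext (fun x => if (a <= x)%O then 0 else e (Order.join x a)).

Definition Uop : 'End(V) := \sum_(a : L | atom a) atom_op a.

Definition vpow (k : nat) : V := iter k Uop (e \bot%O).

Definition dot_beta (u w : V) : R :=
  \sum_(x : L) u x * w x / (beta rk x)%:R.

(* The e_x are orthogonal with <e_x, e_x> = 1 / beta_x, so the e_x-coordinate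
   of the adjoint applied to e_y is beta_x * <F e_x, e_y>;
   see adjoint_betaP below. *)
Definition adjoint_beta (F : 'End(V)) : 'End(V) :=
  linext (fun y =>
    \sum_(x : L) ((beta rk x)%:R * dot_beta (F (e x)) (e y)) *: e x).

Definition Uop_beta : 'End(V) :=
  \sum_(a : L | atom a) adjoint_beta (atom_op a).

Definition Kop : 'End(V) := linext (fun x => (rk x)%:R *: e x).

Definition Sinv : 'End(V) :=
  linext (fun x => if x == \top%O then 0 else (corank x)%:R^-1 *: e x).

Definition D_beta : 'End(V) := (Sinv \o Uop_beta \o Kop)%VF.

(* Product of the graded Moebius algebra:
   e_x e_y = e_(x \/ y) if the ranks add up, and 0 otherwise. *)
Definition mobius_mul (u w : V) : V :=
  \sum_(x : L) \sum_(y : L)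
    if rk (Order.join x y) == (rk x + rk y)%N
    then (u x * w y) *: e (Order.join x y) else 0.

Definition Rspan (r : nat) : {vspace V} := <<mkseq vpow r.+1>>%VS.

Lemma linextE (f : L -> V) (v : V) : linext f v = \sum_(x : L) v x *: f x.
Proof.
rewrite linfun_linear // => c u w; rewrite scaler_sumr -big_split /=.
by apply: eq_bigr => x _; rewrite !ffunE scalerDl scalerA.
Qed.

Lemma linext_e (f : L -> V) (x : L) : linext f (e x) = f x.
Proof.
rewrite linextE (bigD1 x) //= ffunE eqxx scale1r big1 ?addr0 // => y yx.
by rewrite ffunE (negPf yx) scale0r.
Qed.

Lemma sum_e (v : V) : v = \sum_(x : L) v x *: e x.
Proof.
apply/ffunP => y; rewrite sum_ffunE (bigD1 y) //= !ffunE eqxx.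
rewrite [_ *: _]mulr1 big1 ?addr0 // => x xy.
by rewrite !ffunE eq_sym (negPf xy) [_ *: _]mulr0.
Qed.

Lemma dot_beta_e (u : V) (x : L) : dot_beta u (e x) = u x / (beta rk x)%:R.
Proof.
rewrite /dot_beta (bigD1 x) //= ffunE eqxx mulr1 big1 ?addr0 // => y yx.
by rewrite ffunE (negPf yx) mulr0 mul0r.
Qed.

Lemma dot_betaC (u w : V) : dot_beta u w = dot_beta w u.
Proof. by apply: eq_bigr => x _; rewrite [u x * _]mulrC. Qed.

Lemma dot_beta_suml (I : finType) (c : I -> R) (f : I -> V) (w : V) :
  dot_beta (\sum_i c i *: f i) w = \sum_i c i * dot_beta (f i) w.
Proof.
rewrite /dot_beta; under [RHS]eq_bigr do rewrite mulr_sumr.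
rewrite exchange_big /=; apply: eq_bigr => x _.
rewrite sum_ffunE !mulr_suml; apply: eq_bigr => i _.
by rewrite ffunE -!mulrA.
Qed.

Lemma dot_beta_sumr (I : finType) (c : I -> R) (f : I -> V) (w : V) :
  dot_beta w (\sum_i c i *: f i) = \sum_i c i * dot_beta w (f i).
Proof.
rewrite dot_betaC dot_beta_suml; apply: eq_bigr => i _.
by rewrite dot_betaC.
Qed.

Lemma adjoint_betaP (geo : geometric_lattice rk) (F : 'End(V)) (u w : V) :
  dot_beta (F u) w = dot_beta u (adjoint_beta F w).
Proof.
rewrite {1}(sum_e u) linear_sum /=; under eq_bigr do rewrite linearZ /=.
rewrite dot_beta_suml [in RHS](sum_e u) dot_beta_suml.
apply: eq_bigr => x _; congr (_ * _).
rewrite {1}(sum_e w) dot_beta_sumr linextE dot_beta_sumr.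
apply: eq_bigr => y _; congr (_ * _).
rewrite dot_beta_sumr (bigD1 x) //= big1 => [|z zx]; last first.
  by rewrite [dot_beta (e x) _]dot_beta_e ffunE (negPf zx) mul0r mulr0.
rewrite addr0 [dot_beta (e x) (e x)]dot_beta_e ffunE eqxx mul1r mulrC mulKf //.
by rewrite pnatr_eq0 -lt0n beta_gt0.
Qed.

Lemma atom_op_mobius (geo : geometric_lattice rk) (a : L) (u : V) :
  atom a -> atom_op a u = mobius_mul (e a) u.
Proof.
move=> atom_a; rewrite linextE /mobius_mul [RHS](bigD1 a) //= [X in _ = _ + X]big1.
  rewrite addr0; apply: eq_bigr => x _.
  rewrite ffunE eqxx mul1r (rk_covers geo atom_a) (rk_bottom geo) add1n.
  case: ifPn => [ax|nax].
    by rewrite join_r // -[X in X == _]addn0 -addn1 eqn_add2l scaler0.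
  rewrite joinC (_ : _ == _) // eqn_leq; apply/andP; split.
    have := rk_semimodular geo a x.
    rewrite (rk_covers geo atom_a) (rk_bottom geo) add1n.
    by move=> h; apply: leq_trans h; exact: leq_addr.
  by apply: (rk_lt geo); rewrite lt_neqAle leUr andbT eq_sym eq_joinr.
move=> x xa; apply: big1 => y _.
by rewrite ffunE (negPf xa) mul0r scale0r if_same.
Qed.

End Operators.

Section Truncated.
Context {R : realType} (r : nat).

Definition truncpoly := {poly %/ ('X^(r.+1) : {poly R})}.

(* The linear map on R[t]/(t^(r+1)) with t^k |-> f k for 0 <= k <= r. *)
Definition powlin (W : vectType R) (f : nat -> W) : 'Hom(truncpoly, W) :=
  linfun (fun q : truncpoly => \sum_(k < r.+1) (q : {poly R})`_k *: f k).

Definition ddt : 'End(truncpoly) :=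
  powlin (fun k => k%:R *: ('qX : truncpoly) ^+ k.-1).

Lemma coef_qXn (k i : nat) : (k <= r)%N ->
  ((('qX : truncpoly) ^+ k : truncpoly) : {poly R})`_i = (i == k)%:R.
Proof.
move=> kr; rewrite -rmorphXn.
by rewrite in_qpoly_small ?coefXn // mk_monic_Xn !size_polyXn !ltnS.
Qed.

Lemma powlin_qXn (W : vectType R) (f : nat -> W) (k : nat) :
  (k <= r)%N -> powlin f ('qX ^+ k) = f k.
Proof.
move=> kr; rewrite linfun_linear => [|c p q].
  rewrite (bigD1 (Ordinal (kr : k < r.+1)%N)) //= coef_qXn // eqxx scale1r.
  by rewrite big1 ?addr0 // => i ik; rewrite coef_qXn // (negPf (ik : i != k :> nat)) scale0r.
rewrite scaler_sumr -big_split /=; apply: eq_bigr => i _.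
by rewrite coefD coefZ scalerDl scalerA.
Qed.

End Truncated.
Arguments truncpoly : clear implicits.
Arguments powlin {R r W} f.
Arguments ddt {R r}.

(* Main.v *)
Require Import Defs.
From HB Require Import structures.
From mathcomp Require Import all_boot all_order all_algebra.
From mathcomp Require Import reals.

Set Implicit Arguments.
Unset Strict Implicit.
Unset Printing Implicit Defensive.

Import Order.TTheory GRing.Theory Num.Theory.
Local Open Scope ring_scope.

(** The point is that D_beta undoes U on the v_k because v_k is the sum of
    beta_x e_x over the elements x of rank k ([vpowE]): U^k e_\bot runs over
    the k-tuples of atoms, an atom below the current join kills the term, so
    only the tuples whose join has rank k survive, and beta_x counts those
    that reach x.

    For the inner product with <e_x, e_x> = 1 / beta_x this says that
    <v_k, e_y> is 1 when rk y = k and 0 otherwise.  Hence the e_x-coordinate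
    of U^beta v_k, which is beta_x <v_k, U e_x>, is beta_x times the number of
    atoms a not below x such that x \/ a has rank k.  By semimodularity every
    such atom raises the rank by exactly one, so that number is s(x) if x has
    rank k - 1 and 0 otherwise ([dot_vpow_Uop_e]).  Every element is a join of
    atoms, so s(x) is nonzero for x < \top, S^-1 cancels it, and K contributes
    the factor k ([D_beta_vpowS]).

    The rest is formal.  Since D_beta v_k = k v_(k-1), no v_k with k <= r
    vanishes; the v_k have disjoint supports, so t^k |-> v_k is injective.
    It intertwines multiplication by t with U, as v_(r+1) = 0.
    Multiplication by an atom commutes with right multiplications in the
    graded Moebius algebra ([mulr_mobius_Uop]), so v_k w = U^k w, which makes
    t^k |-> v_k multiplicative. *)

(** * Ranks and joins with atoms *)

Section Rank.
Context {d : Order.disp_t} {L : finTBLatticeType d}.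
Variable rk : L -> nat.
Hypothesis geo : geometric_lattice rk.

Lemma rk_le (x y : L) : (x <= y)%O -> (rk x <= rk y)%N.
Proof. by rewrite le_eqVlt => /predU1P[->//|/(rk_lt geo)/ltnW]. Qed.

Lemma rk_atom (a : L) : atom a -> rk a = 1%N.
Proof. by move=> /(rk_covers geo)->; rewrite (rk_bottom geo). Qed.

Lemma rk_join_atom_le (a x : L) :
  atom a -> (rk (Order.join x a) <= (rk x).+1)%N.
Proof.
move=> /rk_atom rka; have := rk_semimodular geo x a.
by rewrite rka addn1; apply: leq_trans; apply: leq_addr.
Qed.

Lemma rk_join_atom (a x : L) :
  atom a -> ~~ (a <= x)%O -> rk (Order.join x a) = (rk x).+1.
Proof.
move=> a_at nax; apply/eqP; rewrite eqn_leq rk_join_atom_le //=.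
by apply: (rk_lt geo); rewrite lt_neqAle leUl andbT eq_sym eq_joinl.
Qed.

Lemma rk_join_atoms_le (t : seq L) :
  all atom t -> (rk (\join_(a <- t) a)%O <= size t)%N.
Proof.
elim: t => [_|a t IHt /=]; first by rewrite big_nil (rk_bottom geo).
move=> /andP[a_at /IHt t_le]; rewrite big_cons joinC.
by apply: leq_trans (rk_join_atom_le _ a_at) _; rewrite ltnS.
Qed.

(** If all atoms were below x, then \top, as a join of atoms, would be too. *)
Lemma corank_gt0 (x : L) : x != \top%O -> (0 < corank x)%N.
Proof.
move=> x1; rewrite subn_gt0; apply: proper_card; apply/properP; split.
  by apply/subsetP => a; rewrite !inE => /andP[].
suff /exists_inP[a a_at nax] : [exists (a : L | atom a), ~~ (a <= x)%O].
  by exists a; rewrite !inE ?a_at.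
apply: contraNT x1 => /exists_inPn H; rewrite -le1x.
rewrite [leLHS](atomistic geo); apply/joinsP => a /andP[/H].
by rewrite negbK.
Qed.

Lemma corankE (x : L) : corank x = (\sum_(a : L | atom a && ~~ (a <= x)%O) 1)%N.
Proof.
rewrite /corank sum1dep_card.
rewrite -(cardsID [set a : L | (a <= x)%O] [set a : L | atom a]).
have -> : [set a : L | atom a] :&: [set a : L | (a <= x)%O] =
          [set a : L | atom a && (a <= x)%O] by apply/setP => a; rewrite !inE.
by rewrite addKn; apply: eq_card => a; rewrite !inE andbC.
Qed.

(** The combinatorial form of associativity in the graded Moebius algebra when
    one factor is an atom: e_a (e_x e_y) and (e_a e_x) e_y vanish together.
    The rank of x \/ y is at most rk x + rk y, and joining a adds at most one,
    so the maximal total rank forces both inequalities to be equalities. *)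
Lemma rk_join_atom_additive (a x y : L) : atom a -> ~~ (a <= x)%O ->
  (rk (Order.join (Order.join x a) y) == (rk (Order.join x a) + rk y)%N) =
  (rk (Order.join x y) == (rk x + rk y)%N) && ~~ (a <= Order.join x y)%O.
Proof.
move=> a_at nax; rewrite (rk_join_atom a_at nax) joinAC.
have xy : (rk (Order.join x y) <= rk x + rk y)%N.
  by apply: leq_trans (rk_semimodular geo x y); apply: leq_addr.
have [axy|naxy] := boolP (a <= Order.join x y)%O; last first.
  by rewrite rk_join_atom // addSn eqSS andbT.
by rewrite andbF join_l // addSn; apply: ltn_eqF; rewrite ltnS.
Qed.

End Rank.

(** * The operators on the powers of the sum of the atoms *)

Section Operators.
Context {R : realType} {d : Order.disp_t} {L : finTBLatticeType d}.
Variable rk : L -> nat.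
Hypothesis geo : geometric_lattice rk.
Local Notation V := {ffun L -> R^o}.
Local Notation e := (@e R d L).
Local Notation Uop := (@Uop R d L).
Local Notation vpow := (@vpow R d L).

Lemma linear_ext_e (f g : 'End(V)) : (forall x, f (e x) = g (e x)) -> f =1 g.
Proof.
move=> fg v; rewrite (sum_e v) !linear_sum; apply: eq_bigr => x _.
by rewrite !linearZ /= fg.
Qed.

Lemma Uop_e (x : L) :
  Uop (e x) = \sum_(a | atom a && ~~ (a <= x)%O) e (Order.join x a).
Proof.
rewrite sum_lfunE [RHS]big_mkcondr /=; apply: eq_bigr => a _.
by rewrite linext_e; case: ifP.
Qed.

Lemma sum_tuple_cons (k : nat) (F : seq L -> V) :
  \sum_(t : k.+1.-tuple L | all atom t) F t =
  \sum_(t : k.-tuple L | all atom t) \sum_(a | atom a) F (a :: t).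
Proof.
rewrite pair_big /=.
rewrite (reindex (fun p : k.-tuple L * L => cons_tuple p.2 p.1)) /=.
  by apply: eq_bigl => p; rewrite andbC.
exists (fun t : k.+1.-tuple L => (behead_tuple t, thead t)).
  by move=> [t a] _; congr pair; apply: val_inj.
by move=> t _; apply: val_inj; rewrite /= [in RHS](tuple_eta t).
Qed.

(** A tuple of k atoms has a join of rank at most k; it contributes to
    U^k e_\bot when no atom lies below the join of those applied before it,
    that is, when the rank of the join is k. *)
Lemma vpow_tuples (k : nat) :
  vpow k = \sum_(t : k.-tuple L | all atom t)
    (if rk (\join_(a <- t) a)%O == k then e (\join_(a <- t) a)%O else 0).
Proof.
elim: k => [|k IHk].
  rewrite (bigD1 [tuple]) //= big_nil (rk_bottom geo) /= big1 ?addr0 //.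
  by move=> t /andP[_ /eqP[]]; exact: tuple0.
rewrite [LHS]/= -/(vpow k) IHk linear_sum /=.
rewrite (sum_tuple_cons _ (fun t => if rk (\join_(a <- t) a)%O == k.+1
  then e (\join_(a <- t) a)%O else 0)).
apply: eq_bigr => t t_at; set x := (\join_(a <- t) a)%O.
have xk : (rk x <= k)%N.
  by have := rk_join_atoms_le geo t_at; rewrite size_tuple.
under eq_bigr => a _ do rewrite big_cons -/x joinC.
(* A deficient rank can never be made up by one more atom. *)
have [rx|nrx] := eqVneq (rk x) k; last first.
  rewrite linear0 big1 // => a a_at; case: eqP => // rxa.
  have := rk_join_atom_le geo x a_at; rewrite rxa ltnS => kx.
  by move: nrx; rewrite eqn_leq xk kx.
rewrite Uop_e big_mkcondr /=; apply: eq_bigr => a a_at.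
have [ax|nax] := boolP (a <= x)%O; last by rewrite rk_join_atom // rx eqxx.
by rewrite join_l // rx ltn_eqF.
Qed.

Lemma vpowE (k : nat) (x : L) :
  vpow k x = if rk x == k then (beta rk x)%:R else 0.
Proof.
rewrite vpow_tuples sum_ffunE.
case: eqP => [<-|rxk]; last first.
  apply: big1 => t _; case: eqP => rt; rewrite !ffunE //.
  by case: eqP => // xt; case: rxk; rewrite xt.
rewrite /beta -sum1dep_card natr_sum [RHS]big_mkcondr /=; apply: eq_bigr => t _.
case: (eqVneq x (\join_(a <- t) a)%O) => [<-|xt].
  by rewrite eqxx ffunE eqxx.
by case: ifP => _; rewrite ffunE ?(negPf xt).
Qed.

Lemma vpow_overflow (k : nat) : (rk \top%O < k)%N -> vpow k = 0.
Proof.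
move=> rk1; apply/ffunP => x; rewrite vpowE ffunE; case: eqP => // rx.
by move: rk1; rewrite ltnNge -rx (rk_le geo (lex1 x)).
Qed.

(** The e_x-coordinate is beta_x times the inner product with e_x; moving the
    adjoint across gives U e_x. *)
Lemma Uop_beta_coord (w : V) (x : L) :
  Uop_beta rk w x = (beta rk x)%:R * dot_beta rk w (Uop (e x)).
Proof.
have bx : (beta rk x)%:R != 0 :> R by rewrite pnatr_eq0 -lt0n beta_gt0.
suff -> : dot_beta rk w (Uop (e x)) = dot_beta rk (Uop_beta rk w) (e x).
  by rewrite dot_beta_e mulrC divfK.
have dot_sumr (F : L -> V) u : dot_beta rk u (\sum_(a | atom a) F a) =
    \sum_(a | atom a) dot_beta rk u (F a).
  rewrite /dot_beta exchange_big; apply: eq_bigr => y _.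
  by rewrite sum_ffunE mulr_sumr mulr_suml.
rewrite [RHS]dot_betaC !sum_lfunE !dot_sumr; apply: eq_bigr => a _.
by rewrite dot_betaC adjoint_betaP.
Qed.

(** As <v_k, e_y> is the indicator of rk y = k, the inner product counts the
    atoms a not below x with x \/ a of rank k. *)
Lemma dot_vpow_Uop_e (k : nat) (x : L) :
  dot_beta rk (vpow k) (Uop (e x)) =
  if (rk x).+1 == k then (corank x)%:R else 0.
Proof.
rewrite Uop_e /dot_beta.
under eq_bigr => y _ do rewrite sum_ffunE mulr_sumr mulr_suml.
rewrite exchange_big /=.
transitivity (\sum_(a | atom a && ~~ (a <= x)%O)
    (if (rk x).+1 == k then 1 else 0 : R)); last first.
  by case: eqP => _; rewrite ?big1_eq // corankE natr_sum.
apply: eq_bigr => a /andP[a_at nax].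
have := dot_beta_e rk (vpow k) (Order.join x a); rewrite /dot_beta => ->.
rewrite vpowE rk_join_atom //; case: eqP => _; last by rewrite mul0r.
by rewrite divff // pnatr_eq0 -lt0n beta_gt0.
Qed.

Lemma diag_coord (c : L -> R) (v : V) (x : L) :
  linext (fun y => c y *: e y) v x = c x * v x.
Proof.
rewrite linextE sum_ffunE (bigD1 x) //= big1 => [|y yx].
  by rewrite !ffunE eqxx addr0 [c x *: _]mulr1 [_ *: _]mulrC.
by rewrite !ffunE eq_sym (negPf yx) [c y *: _]mulr0 [_ *: _]mulr0.
Qed.

Lemma Kop_vpow (k : nat) : Kop rk (vpow k) = k%:R *: vpow k.
Proof.
apply/ffunP => x; rewrite diag_coord [RHS]ffunE vpowE.
by case: eqP => [->|_] //; rewrite mulr0 [RHS]mulr0.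
Qed.

Lemma D_beta_vpow0 : D_beta rk (vpow 0) = 0.
Proof. by rewrite !comp_lfunE Kop_vpow scale0r !linear0. Qed.

Lemma D_beta_vpowS (k : nat) : (k < rk \top%O)%N ->
  D_beta rk (vpow k.+1) = k.+1%:R *: vpow k.
Proof.
move=> kr; rewrite !comp_lfunE Kop_vpow !linearZ; congr (_ *: _).
apply/ffunP => x.
pose c (y : L) : R := if y == \top%O then 0 else (corank y)%:R^-1.
have SinvE : Sinv =1 linext (fun y => c y *: e y).
  apply: linear_ext_e => y; rewrite !linext_e /c.
  by case: ifP; rewrite ?scale0r.
transitivity (linext (fun y => c y *: e y) (Uop_beta rk (vpow k.+1)) x).
  by rewrite -SinvE.
rewrite diag_coord Uop_beta_coord dot_vpow_Uop_e vpowE eqSS.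
case: eqP => [rx|_]; last by rewrite !mulr0.
have x1 : x != \top%O by apply: contraTneq kr => <-; rewrite rx ltnn.
rewrite /c (negPf x1) mulrC mulfK // pnatr_eq0 -lt0n.
exact: corank_gt0 geo _ x1.
Qed.

(** D_beta takes v_(k+1) to a nonzero multiple of v_k, so nonvanishing
    propagates upwards from v_0 = e_\bot. *)
Lemma vpow_neq0 (k : nat) : (k <= rk \top%O)%N -> vpow k != 0.
Proof.
elim: k => [_|k IHk kr].
  by apply/eqP => /ffunP/(_ \bot%O)/eqP; rewrite !ffunE eqxx oner_eq0.
apply: contraNneq (IHk (ltnW kr)) => vk0.
have := D_beta_vpowS kr; rewrite vk0 linear0 => /esym/eqP.
by rewrite scaler_eq0 pnatr_eq0.
Qed.

(** Right multiplication in the graded Moebius algebra, packaged as a linear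
    map so that identities in the left factor can be checked on the basis. *)
Definition mulr_mobius (w : V) : 'End(V) :=
  linext (fun x => \sum_(y : L) w y *:
    (if rk (Order.join x y) == (rk x + rk y)%N then e (Order.join x y) else 0)).

Lemma mulr_mobiusE (u w : V) : mulr_mobius w u = mobius_mul rk u w.
Proof.
rewrite linextE; apply: eq_bigr => x _; rewrite scaler_sumr.
by apply: eq_bigr => y _; rewrite scalerA; case: ifP; rewrite ?scaler0.
Qed.

Lemma mulr_mobius_bot (w : V) : mulr_mobius w (e \bot%O) = w.
Proof.
rewrite linext_e [RHS]sum_e; apply: eq_bigr => y _.
by rewrite join0x (rk_bottom geo) eqxx.
Qed.

(** U is left multiplication by the sum of the atoms, so this is
    associativity, checked on one atom and two basis vectors at a time. *)
Lemma mulr_mobius_Uop (u w : V) :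
  mulr_mobius w (Uop u) = Uop (mulr_mobius w u).
Proof.
rewrite -!comp_lfunE; move: u; apply: linear_ext_e => x; rewrite !comp_lfunE.
rewrite !sum_lfunE linear_sum; apply: eq_bigr => a a_at.
rewrite !linext_e linear_sum /=.
have [ax|nax] := boolP (a <= x)%O.
  rewrite linear0 big1 // => y _; rewrite linearZ /=; case: ifP => _.
    by rewrite linext_e (le_trans ax (leUl _ _)) scaler0.
  by rewrite linear0 scaler0.
rewrite linext_e; apply: eq_bigr => y _; rewrite linearZ /=; congr (_ *: _).
rewrite rk_join_atom_additive // joinAC.
case: eqP => _ /=; last by rewrite linear0.
by rewrite linext_e; case: (a <= _)%O.
Qed.

Lemma vpow_mul (k : nat) (w : V) :
  mobius_mul rk (vpow k) w = iter k Uop w.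
Proof.
rewrite -mulr_mobiusE; elim: k => [|k IHk] /=; first exact: mulr_mobius_bot.
by rewrite mulr_mobius_Uop -IHk.
Qed.

End Operators.

(** * Truncated polynomials *)

Section Truncated.
Context {R : realType} (r : nat).
Local Notation qX := ('qX : truncpoly R r).

Lemma truncpoly_sum (q : truncpoly R r) :
  q = \sum_(k < r.+1) (q : {poly R})`_k *: qX ^+ k.
Proof.
apply/val_inj/polyP => i; rewrite /= [RHS]coefn_sum.
have [ir|ri] := ltnP i r.+1.
  rewrite (bigD1 (Ordinal ir)) //= coefZ coef_qXn // eqxx mulr1 big1 ?addr0 //.
  move=> k ki; rewrite coefZ coef_qXn -1?ltnS // eq_sym.
  by rewrite (negPf (ki : k != i :> nat)) mulr0.
rewrite nth_default ?big1 // => [k _|].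
  rewrite coefZ coef_qXn -1?ltnS // [i == k]gtn_eqF ?mulr0 //.
  exact: leq_trans (ltn_ord k) ri.
have sz : (size (mk_monic ('X^(r.+1) : {poly R}))).-1 = r.+1.
  by rewrite mk_monic_Xn size_polyXn.
by apply: leq_trans ri; rewrite -[leqRHS]sz; exact: size_npoly.
Qed.

Lemma qX_overflow : qX ^+ r.+1 = 0.
Proof.
apply/val_inj; rewrite -rmorphXn /= mk_monic_Xn /=.
by rewrite Pdiv.RingMonic.rmodpp // monicXn.
Qed.

Lemma truncpoly_linear_ext (W : vectType R) (f g : truncpoly R r -> W) :
  linear f -> linear g ->
  (forall k, (k <= r)%N -> f (qX ^+ k) = g (qX ^+ k)) -> f =1 g.
Proof.
move=> f_lin g_lin fg q.
rewrite -(linfun_linear f_lin) -(linfun_linear g_lin) (truncpoly_sum q).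
rewrite !linear_sum; apply: eq_bigr => k _; rewrite !linearZ /=.
by rewrite !linfun_linear // fg // -ltnS.
Qed.

Lemma powlinE (W : vectType R) (f : nat -> W) (q : truncpoly R r) :
  powlin f q = \sum_(k < r.+1) (q : {poly R})`_k *: f k.
Proof.
rewrite {1}(truncpoly_sum q) linear_sum; apply: eq_bigr => k _.
by rewrite linearZ /= powlin_qXn // -ltnS.
Qed.

End Truncated.

(** * The subalgebra spanned by the powers of the sum of the atoms *)

Section RankSubalgebra.
Context {R : realType} {d : Order.disp_t} {L : finTBLatticeType d}.
Variable rk : L -> nat.
Hypothesis geo : geometric_lattice rk.
Local Notation r := (rk \top%O).
Local Notation vpow := (@vpow R d L).
Local Notation phi := (powlin vpow : 'Hom(truncpoly R r, {ffun L -> R^o})).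
Local Notation qX := ('qX : truncpoly R r).

Lemma Uop_powlin_vpow (q : truncpoly R r) : Uop (phi q) = phi (qX * q).
Proof.
move: q; apply: truncpoly_linear_ext => [c p q|c p q|k kr].
- by rewrite !linearP.
- by rewrite mulrDr -scalerAr linearP.
rewrite -exprS (powlin_qXn _ kr) -[Uop _]/(vpow k.+1).
have [kr1|rk1] := ltnP k r; first by rewrite powlin_qXn.
(* The only boundary case: both t^(r+1) and v_(r+1) vanish. *)
have -> : k = r by apply/eqP; rewrite eqn_leq kr rk1.
by rewrite qX_overflow linear0; exact: (vpow_overflow geo).
Qed.

Lemma D_beta_powlin_vpow (q : truncpoly R r) :
  D_beta rk (phi q) = phi (ddt q).
Proof.
move: q; apply: truncpoly_linear_ext => [c p q|c p q|k kr];
  rewrite ?linearP //.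
rewrite powlin_qXn // /ddt powlin_qXn // linearZ /=.
case: k kr => [|k] kr; first by rewrite D_beta_vpow0 // scale0r.
by rewrite (D_beta_vpowS geo kr) powlin_qXn // ltnW.
Qed.

(** The v_k are nonzero and have disjoint supports, the rank levels of L, so
    they are linearly independent. *)
Lemma lker_powlin_vpow : lker phi = 0%VS.
Proof.
apply/eqP/lker0P => p q /eqP; rewrite -subr_eq0 -linearB /= => /eqP phi0.
apply/eqP; rewrite -subr_eq0; move: (p - q) phi0 => {p q} q.
rewrite powlinE => /ffunP phi0; rewrite (truncpoly_sum q) big1 // => k _.
have /eqP vk0 : vpow k != 0 by apply: (vpow_neq0 geo); rewrite -ltnS.
have [x vkx] : exists x, vpow k x != 0.
  apply/existsP; apply: contra_notT vk0 => /existsPn vk0.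
  by apply/ffunP => x; rewrite [RHS]ffunE; apply/eqP; rewrite -[_ == _]negbK.
have rx : rk x = k.
  by apply: contraNeq vkx => rxk; rewrite (vpowE geo) (negPf rxk).
move: (phi0 x); rewrite sum_ffunE (bigD1 k) //= big1 => [|j jk]; last first.
  rewrite ffunE (vpowE geo) rx eq_sym.
  by rewrite (negPf (jk : j != k :> nat)) [_ *: _]mulr0.
rewrite addr0 !ffunE => /eqP; rewrite [_ *: _ == 0]mulf_eq0 (negPf vkx) orbF.
by move=> /eqP->; rewrite scale0r.
Qed.

Lemma limg_powlin_vpow : limg phi = Rspan r.
Proof.
apply/eqP; rewrite eqEsubv; apply/andP; split.
  apply/subvP => _ /memv_imgP[q _ ->]; rewrite powlinE.
  apply: memv_suml => k _; apply/memvZ/memv_span.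
  by apply/mapP; exists (k : nat) => //; rewrite mem_iota add0n ltn_ord.
apply/span_subvP => _ /mapP[k + ->]; rewrite mem_iota add0n ltnS => kr.
by rewrite -(powlin_qXn _ kr) memv_img // memvf.
Qed.

(** Both sides are linear in p, and for p = t^k both are U^k (phi q). *)
Lemma powlin_vpowM (p q : truncpoly R r) :
  phi (p * q) = mobius_mul rk (phi p) (phi q).
Proof.
rewrite -mulr_mobiusE.
move: p; apply: truncpoly_linear_ext => [c p p'|c p p'|k kr].
- by rewrite mulrDl -scalerAl linearP.
- by rewrite !linearP.
rewrite (powlin_qXn _ kr) mulr_mobiusE (vpow_mul geo).
elim: k {kr} => [|k IHk]; first by rewrite expr0 mul1r.
by rewrite (exprS qX) -mulrA -Uop_powlin_vpow IHk.
Qed.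

End RankSubalgebra.

Theorem proposition2p3 (R : realType) (d : Order.disp_t)
    (L : finTBLatticeType d) (rk : L -> nat) (r : nat)
    (geoL : geometric_lattice rk) (rkL : rk \top%O = r) :
  let U : 'End({ffun L -> R^o}) := Uop in
  let D : 'End({ffun L -> R^o}) := D_beta rk in
  let v : nat -> {ffun L -> R^o} := vpow in
  let phi : 'Hom(truncpoly R r, {ffun L -> R^o}) := powlin v in
  [/\ D (v 0%N) = 0,
      forall k : nat, (1 <= k <= r)%N -> D (v k) = k%:R *: v k.-1,
      [/\ lker phi = 0%VS, limg phi = Rspan r, phi 1 = e \bot%O
        & forall p q : truncpoly R r,
            phi (p * q) = mobius_mul rk (phi p) (phi q)],
      forall q : truncpoly R r, U (phi q) = phi ('qX * q)
    & forall q : truncpoly R r, D (phi q) = phi (ddt q)].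
Proof.
subst r; split.
- exact: D_beta_vpow0.
- by case=> // k kr; exact: D_beta_vpowS.
- split; [exact: lker_powlin_vpow|exact: limg_powlin_vpow| |].
    by rewrite -(expr0 ('qX : truncpoly R (rk \top%O))) powlin_qXn.
  exact: powlin_vpowM.
- exact: Uop_powlin_vpow.
exact: D_beta_powlin_vpow.
Qed.
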